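(* Let $s>2$ be a rational number that is not an integer, let $t>1$ be an integer with $p=st$ an integer, and write $q=\lceil s\rceil$. Let $\xi_1,\dots,\xi_q$ be positive integers with $\xi_{q-1}\binom{p-t}{(q-2)t+1}=\xi_q$, $\binom{p-t}{(r-1)t+1}\xi_r=\binom{p-t}{rt}\xi_{r+1}$ for $2\le r\le q-2$, and $(p-t)\xi_1=t\binom{p-t}{t}\xi_2$. Let $\mathcal{C}$ be the array code (over a finite field $\mathbb{F}$, with $t$ rows, entries in $\mathbb{F}^p$ with basis $x_1,\dots,x_p$) whose columns are: (Type $T_1$) for each $t$-subset $A\subseteq\{1,\dots,p\}$, $\xi_1$ columns with cells $x_a$, $a\in A$; (Type $T_r$, $2\le r\le q-1$) for each $(t-1)$-subset $B$ and each $((r-1)t+1)$-subset $C\subseteq\{1,\dots,p\}\setminus B$, $\xi_r$ columns with cells $x_b$ ($b\in B$) and one cell $\sum_{c\in C}x_c$; (Type $T_q$) for each $(t-1)$-subset $B$, $\xi_q$ columns with cells $x_b$ ($b\in B$) and one cell $\sum_{c\notin B}x_c$. Let $m$ be the number of columns. Then $\mathcal{C}$ is a $[t\times m,p]$ $k$-PIR array code with PIR rate $k/m=(\beta+\gamma)/(\beta+2\gamma)$, where \[ \beta=\xi_1(p-t+1)+\sum_{r=2}^{q-1}(t-1)\xi_r\binom{p-t+1}{(r-1)t+1}+(t-1)\xi_q,\qquad \gamma=(p-t+1)\Big(\sum_{r=1}^{q-2}\xi_{r+1}\binom{p-t}{rt}+\xi_q\Big). \]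
   Context: A $[t\times m,p]$ array code is a $t\times m$ array whose entries are linear combinations of a basis $x_1,\dots,x_p$ of $\mathbb{F}^p$. It has the $k$-PIR property (is a $k$-PIR array code) if for every $i$ there exist $k$ pairwise disjoint sets $S_1,\dots,S_k$ of columns such that for each $j$ the vector $x_i$ lies in the span of all entries of the columns in $S_j$. Its PIR rate is $k/m$. *)

(* Defs.v *)
From HB Require Import structures.
From mathcomp Require Import all_boot all_order all_algebra.
Set Implicit Arguments. Unset Strict Implicit. Unset Printing Implicit Defensive.
Import Order.TTheory GRing.Theory Num.Theory.
Local Open Scope ring_scope.

Definition xvec (F : fieldType) (p : nat) (i : 'I_p) : 'rV[F]_p := delta_mx 0 i.

(* An array code is a list of columns; each column is the list of its cells
   (vectors of F^p). Columns are indexed by 'I_(size C). *)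
Definition column (F : fieldType) (p : nat) (C : seq (seq 'rV[F]_p))
  (c : 'I_(size C)) : seq 'rV[F]_p := nth [::] C c.

Definition is_kPIR (F : fieldType) (p : nat) (C : seq (seq 'rV[F]_p)) (k : nat)
  : Prop :=
  forall i : 'I_p, exists S : 'I_k -> {set 'I_(size C)},
    (forall j1 j2 : 'I_k, j1 != j2 -> [disjoint S j1 & S j2]) /\
    (forall j : 'I_k,
       (xvec F i <= \sum_(c in S j) \sum_(v <- column c) <<v>>)%MS).

Definition is_array_code (F : fieldType) (p t : nat) (C : seq (seq 'rV[F]_p)) :=
  all (fun col => size col == t) C.

Definition ksubsets (p k : nat) : seq {set 'I_p} :=
  filter (fun A : {set 'I_p} => #|A| == k) (enum {set 'I_p}).

Definition colA (F : fieldType) (p : nat) (A : {set 'I_p}) : seq 'rV[F]_p :=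
  [seq xvec F a | a <- enum A].

Definition colB (F : fieldType) (p : nat) (B : {set 'I_p}) (v : 'rV[F]_p)
  : seq 'rV[F]_p := rcons [seq xvec F b | b <- enum B] v.

Definition code_C (F : fieldType) (p t q : nat) (xi : nat -> nat)
  : seq (seq 'rV[F]_p) :=
  flatten [seq nseq (xi 1%N) (colA F A) | A : {set 'I_p} <- ksubsets p t]
  ++ flatten [seq
       flatten [seq
         flatten [seq nseq (xi r) (colB B (\sum_(c in Cs) xvec F c))
                 | Cs : {set 'I_p} <- filter (fun Cs : {set 'I_p} => Cs \subset ~: B)
                                (ksubsets p (r.-1 * t).+1)]
       | B : {set 'I_p} <- ksubsets p t.-1]
     | r <- iota 2 (q - 2)]
  ++ flatten [seq nseq (xi q) (colB B (\sum_(c in ~: B) xvec F c))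
             | B : {set 'I_p} <- ksubsets p t.-1].

Definition beta_of (p t q : nat) (xi : nat -> nat) : nat :=
  (xi 1 * (p - t + 1)
   + \sum_(2 <= r < q) (t - 1) * xi r * 'C(p - t + 1, (r - 1) * t + 1)
   + (t - 1) * xi q)%N.

Definition gamma_of (p t q : nat) (xi : nat -> nat) : nat :=
  ((p - t + 1) * (\sum_(1 <= r < q - 1) xi r.+1 * 'C(p - t, r * t) + xi q))%N.

(* Main.v *)
Require Import Defs.
From HB Require Import structures.
From mathcomp Require Import all_boot all_order all_algebra.
From mathcomp Require Import perm zify ring.
Import Order.TTheory GRing.Theory Num.Theory.
Set Implicit Arguments. Unset Strict Implicit. Unset Printing Implicit Defensive.
Local Open Scope ring_scope.

(** Fix [i]. A column with [x_i] among its first cells recovers [x_i] alone.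
    Every other column is used in exactly one recovering pair: a column of type
    T_r not involving [x_i] gives the sum over its [r t] indices, which cancels
    the tail of a column of type T_(r+1) whose last cell is [x_i] plus that sum.
    For [r <= q - 2] the equations on [xi] say that both kinds are equally
    numerous for each [r t]-set. For [r = q - 1] one needs, for each [C], a
    permutation [phi] of the [(t-1)]-subsets of the complement of [C] and [i]
    such that [B] and [phi B] always cover it.
    With [s] single columns and [d] pairs, [k = s + d] and [m = s + 2 d], and
    [s], [d] are proportional to [beta], [gamma]. *)

(** * Inclusion matrices of [k]-subsets and covering permutations *)

Definition ksets (T : finType) (U : {set T}) (k : nat) : {set {set T}} :=
  [set B : {set T} | (B \subset U) && (#|B| == k)].

(** Injectivity of an inclusion matrix. The vanishing first descends to all smaller [Y], then
    inclusion-exclusion extends it to sums over the [B] that contain [Y] and avoid [Z], for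
    [#|Y| + #|Z| <= #|U| - k]. Avoiding the complement of a single [k]-subset isolates its value. *)
Lemma superset_sums_eq0 (T : finType) (U : {set T}) (k : nat)
    (f : {set T} -> rat) :
  (#|U| <= k.*2)%N ->
  (forall Y : {set T}, Y \subset U -> #|Y| = (#|U| - k)%N ->
     \sum_(B in ksets U k | Y \subset B) f B = 0) ->
  forall B, B \in ksets U k -> f B = 0.
Proof.
move=> leUk vanish.
have small d : forall Y : {set T}, Y \subset U -> (#|Y| + d = #|U| - k)%N ->
    \sum_(B in ksets U k | Y \subset B) f B = 0.
  elim: d => [|d IHd] Y sYU cardY; first by apply: vanish => //; lia.
  (* Summing over one-point enlargements of [Y] counts each [B] containing [Y] once per element of
     [B :\: Y], that is [k - #|Y|] times. This is nonzero since [#|Y| < #|U| - k <= k]. *)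
  have: \sum_(z in U :\: Y) \sum_(B in ksets U k | z |: Y \subset B) f B = 0.
    apply: big1 => z /setDP[zU zY]; apply: IHd; last by rewrite cardsU1 zY; lia.
    by rewrite subUset sub1set zU.
  rewrite (exchange_big_dep (fun B => (B \in ksets U k) && (Y \subset B))) /=; last first.
    by move=> z B _ /andP[-> /=]; rewrite subUset => /andP[].
  rewrite (eq_bigr (fun B => f B *+ (k - #|Y|))); last first.
    move=> B /andP[]; rewrite inE => /andP[sBU /eqP cardB] sYB.
    rewrite (eq_bigl [in B :\: Y]) ?sumr_const.
      by rewrite cardsD (setIidPr sYB) cardB.
    move=> z; rewrite !inE sBU cardB eqxx subUset sub1set sYB !andbT /=.
    by case: (boolP (z \in B)) => [/(subsetP sBU)->|]; rewrite ?andbF ?andbT.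
  rewrite sumrMnl => /eqP; rewrite -mulr_natr mulf_eq0 => /orP[/eqP//|].
  by rewrite pnatr_eq0; lia.
have avoid n : forall Y Z : {set T}, #|Z| = n -> Y \subset U -> Z \subset U ->
    (#|Y| + n <= #|U| - k)%N ->
    \sum_(B in ksets U k | (Y \subset B) && [disjoint Z & B]) f B = 0.
  elim: n => [|n IHn] Y Z cardZ sYU sZU leYZ.
    rewrite -[RHS](@small (#|U| - k - #|Y|)%N Y sYU); last by lia.
    apply: eq_bigl => B; move/eqP: cardZ; rewrite cards_eq0 => /eqP->.
    by rewrite -setI_eq0 set0I eqxx andbT.
  have /card_gt0P[z zZ] : (0 < #|Z|)%N by rewrite cardZ.
  have cardZz : #|Z :\ z| = n by move: (cardsD1 z Z); rewrite zZ cardZ; lia.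
  have sZz : Z :\ z \subset U by apply: subset_trans (subsetDl _ _) sZU.
  (* The sets avoiding [Z :\ z] either contain [z] or avoid all of [Z]. The total vanishes by
     induction, and so does the first part, by induction with [z |: Y]; if [z] lies in [Y], the sum
     sought is empty. *)
  have := IHn Y (Z :\ z) cardZz sYU sZz ltac:(lia).
  rewrite (bigID (fun B : {set T} => z \in B)) /=.
  case: (boolP (z \in Y)) => [zY _|zY].
    apply: big_pred0 => B; apply/negbTE; apply/negP=> /and3P[_ /subsetP/(_ z zY) zB].
    by move=> /disjointFr/(_ zZ); rewrite zB.
  have := IHn (z |: Y) (Z :\ z) cardZz _ sZz.
  rewrite subUset sub1set (subsetP sZU _ zZ) cardsU1 zY => /(_ sYU ltac:(lia)) E1.
  rewrite [X in X + _](_ : _ = 0) ?add0r; last first.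
    rewrite -[RHS]E1; apply: eq_bigl => B; rewrite subUset sub1set.
    by case: (z \in B); rewrite ?andbT ?andbF ?andbA.
  move=> E2; rewrite -[RHS]E2; apply: eq_bigl => B; rewrite -!andbA; do 2 congr andb.
  rewrite -[in LHS](setD1K zZ) -!setI_eq0 setIUl setU_eq0 andbC; congr andb.
  by rewrite setI_eq0 disjoints1.
move=> B0 B0k; move: (B0k); rewrite inE => /andP[sB0 /eqP cardB0].
(* [U :\: B0] has exactly [#|U| - k] elements, and [B0] is the only [k]-subset of [U] avoiding
   it. *)
have := avoid _ set0 (U :\: B0) erefl (sub0set _) (subsetDl _ _).
rewrite cards0 cardsD (setIidPr sB0) cardB0 => /(_ (leqnn _)) <-.
rewrite (big_pred1 B0) // => B; rewrite sub0set /= inE -andbA.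
apply/idP/eqP=> [/and3P[sB /eqP cardB dB]|->].
  apply/eqP; rewrite eqEcard cardB cardB0 leqnn andbT.
  apply/subsetP=> x xB; move: (disjointFl dB xB); rewrite !inE (subsetP sB _ xB).
  by move/negbT; rewrite andbT negbK.
by rewrite sB0 cardB0 eqxx -setI_eq0 setIDAC setDIl setDv setI0 eqxx.
Qed.

(* The matrix [U \subset B :|: B'] over the k-subsets of U is nonsingular, so
   the Leibniz expansion of its determinant has a nonzero term. *)
Lemma covering_permutation (T : finType) (U : {set T}) (k : nat) :
  (#|U| <= k.*2)%N ->
  exists phi : {set T} -> {set T},
    [/\ {in ksets U k &, injective phi},
        {in ksets U k, forall B, phi B \in ksets U k} &
        {in ksets U k, forall B, U \subset B :|: phi B}].
Proof.
move=> leUk; pose X := ksets U k.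
case: (set_0Vmem X) => [X0 | [B1 B1X]].
  by exists id; split=> [B B'|B|B]; rewrite -/X X0 inE.
pose M : 'M[rat]_#|X| :=
  \matrix_(a, b) (U \subset enum_val a :|: enum_val b)%:R.
have detM : \det M != 0.
  apply/negP=> /det0P[v /rV0Pn v0 vM0].
  (* A kernel vector is read as a function on [k]-subsets. Its equation at the column [U :\: Y] is
     the superset sum at [Y], because [B] and [U :\: Y] cover [U] exactly when [Y] lies in [B]. *)
  pose f B := v 0 (enum_rank_in B1X B).
  case: v0 => a /eqP; apply.
  rewrite -(enum_valK_in B1X a); apply: (superset_sums_eq0 (f := f) leUk).
    move=> Y sYU cardY.
    have YcX : U :\: Y \in X.
      have := B1X; rewrite !inE subsetDl cardsD (setIidPr sYU) cardY.
      by case/andP=> /subset_leq_card leB /eqP cardB; apply/eqP; lia.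
    have := congr1 (fun w : 'rV_ _ => w 0 (enum_rank_in B1X (U :\: Y))) vM0.
    rewrite !mxE => sum0; rewrite -[RHS]sum0.
    rewrite big_mkcondr /= big_enum_val /=.
    apply: eq_bigr => b _; rewrite mxE /f enum_valK_in enum_rankK_in //.
    suff ->: (U \subset enum_val b :|: U :\: Y) = (Y \subset enum_val b).
      by case: ifP; rewrite ?mulr1 ?mulr0.
    apply/subsetP/subsetP => sub x xP.
      by have := sub x (subsetP sYU x xP); rewrite !inE xP orbF.
    by rewrite !inE xP andbT orbC; case: (boolP (x \in Y)) => //= /sub->.
  exact: enum_valP.
have [s sP] : exists s : 'S_(#|X|), \prod_a M a (s a) != 0.
  case: (pickP (fun s : 'S_(#|X|) => \prod_a M a (s a) != 0)) => [s sP|noS].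
    by exists s.
  case/negP: detM; apply/eqP; apply: big1 => s _.
  by have /negbFE/eqP-> := noS s; rewrite mulr0.
exists (fun B => enum_val (s (enum_rank_in B1X B))); split=> [B B' BX B'X|B _|B BX].
- by move/enum_val_inj/perm_inj/(congr1 enum_val); rewrite !enum_rankK_in.
- exact: enum_valP.
- move/prodf_neq0/(_ (enum_rank_in B1X B) isT): sP.
  by rewrite mxE enum_rankK_in // pnatr_eq0; case: (U \subset _).
Qed.

(** * Recovery sets, and splittings of a code into single columns and pairs *)

(** Works on lists of column values, so that repeated columns can be grouped without naming their
    positions in the code. *)
Definition span_of (F : fieldType) (p : nat) (l : seq (seq 'rV[F]_p)) : 'M[F]_p :=
  (\sum_(c <- l) \sum_(v <- c) <<v>>)%MS.

Lemma mem_span_of (F : fieldType) (p : nat) (l : seq (seq 'rV[F]_p)) c v :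
  c \in l -> v \in c -> (v <= span_of l)%MS.
Proof.
move=> cl vc; rewrite /span_of (big_rem c) //= (big_rem v) //=.
apply: submx_trans (addsmxSl _ _); apply: submx_trans (addsmxSl _ _).
by rewrite genmxE.
Qed.

Lemma span_of_sub (F : fieldType) (p : nat) (l : seq (seq 'rV[F]_p))
    (M : 'M[F]_p) :
  (forall c v, c \in l -> v \in c -> (v <= M)%MS) -> (span_of l <= M)%MS.
Proof.
move=> sub; rewrite /span_of big_seq.
elim/big_rec: _ => [|c N cl sN]; first exact: sub0mx.
rewrite addsmx_sub sN andbT big_seq.
elim/big_rec: _ => [|v N' vc sN']; first exact: sub0mx.
by rewrite addsmx_sub sN' andbT genmxE (sub c).
Qed.

(** Passes from groups of column values to disjoint sets of column indices. The permutation gives a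
    duplicate-free list [Is] of indices, cut into consecutive blocks by the groups of [L]. *)
Lemma disjoint_recovery_sets (F : fieldType) (p : nat)
    (C : seq (seq 'rV[F]_p)) (x : 'rV[F]_p) (L : seq (seq (seq 'rV[F]_p))) :
  perm_eq (flatten L) C -> {in L, forall l, (x <= span_of l)%MS} ->
  exists S : 'I_(size L) -> {set 'I_(size C)},
    (forall j1 j2, j1 != j2 -> [disjoint S j1 & S j2]) /\
    (forall j, (x <= \sum_(c in S j) \sum_(v <- column c) <<v>>)%MS).
Proof.
case/(perm_iotaP [::]) => Is permIs flatL good.
have uniqIs : uniq Is by rewrite (perm_uniq permIs) iota_uniq.
(* An index belongs to the block in which its position in [Is] falls, so it cannot belong to two. *)
exists (fun j : 'I_(size L) => [set c | reshape_index (shape L) (index (val c) Is) == j :> nat]).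
split=> [j1 j2 j12|j].
  rewrite -setI_eq0; apply/eqP/setP=> c; rewrite !inE; apply/negbTE/negP.
  by case/andP=> /eqP-> /eqP/val_inj e; rewrite e eqxx in j12.
apply: submx_trans (good _ (mem_nth [::] (ltn_ord j))) _.
apply: span_of_sub => c v cl vc.
(* The value [c] sits at offset [o] of group [j], hence at position [e] of the concatenation; the
   entry of [Is] there is an index of [c] in the code. *)
set l := nth [::] L j in cl; pose o := index c l.
have lt_o : (o < nth 0 (shape L) j)%N by rewrite (nth_map [::]) // index_mem.
pose e := flatten_index (shape L) j o.
have lt_e : (e < size Is)%N.
  by rewrite -(size_map (nth [::] C)) -flatL size_flatten; apply: flatten_indexP.
have lt_c : (nth 0 Is e < size C)%N.
  by have := mem_nth 0%N lt_e; rewrite (perm_mem permIs) mem_iota.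
have nth_c : nth [::] C (nth 0 Is e) = c.
  rewrite -(nth_map 0%N [::] (nth [::] C)) // -flatL nth_flatten.
  by rewrite flatten_indexKl // flatten_indexKr // nth_index.
apply: (sumsmx_sup (Ordinal lt_c)); first by rewrite inE /= index_uniq // flatten_indexKl.
rewrite /column /= nth_c (big_rem v) //=.
by apply: submx_trans (addsmxSl _ _); rewrite genmxE.
Qed.

(* The multiset of columns being split is represented by its counting function [f]. *)
Definition splits (F : fieldType) (p : nat) (x : 'rV[F]_p)
    (f : pred (seq 'rV[F]_p) -> nat) (s d : nat) : Prop :=
  exists (L1 : seq (seq 'rV[F]_p)) (L2 : seq (seq 'rV[F]_p * seq 'rV[F]_p)),
    [/\ size L1 = s, size L2 = d,
        {in L1, forall c, (x <= span_of [:: c])%MS},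
        {in L2, forall e, (x <= span_of [:: e.1; e.2])%MS} &
        forall a, (count a L1 + (count a (map fst L2) + count a (map snd L2)))%N
                  = f a].

Lemma splits_size (F : fieldType) (p : nat) (x : 'rV[F]_p) C s d :
  splits x (fun a => count a C) s d -> size C = (s + 2 * d)%N.
Proof.
by case=> L1 [L2 [<- <- _ _ /(_ predT)]]; rewrite !count_predT !size_map => <-; lia.
Qed.

Lemma splits_is_kPIR (F : fieldType) (p : nat) (C : seq (seq 'rV[F]_p)) s d :
  (forall i, splits (xvec F i) (fun a => count a C) s d) -> is_kPIR C (s + d).
Proof.
move=> splitC i; have [L1 [L2 [size1 size2 good1 good2 cnt]]] := splitC i.
pose L := [seq [:: c] | c <- L1] ++ [seq [:: e.1; e.2] | e <- L2].
have <- : size L = (s + d)%N by rewrite size_cat !size_map size1 size2.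
apply: disjoint_recovery_sets => [|l].
  apply/seq.permP=> a; rewrite -cnt flatten_cat count_cat flatten_seq1; congr addn.
  by elim: {L good2 cnt size2} L2 => //= e L2 ->; lia.
by rewrite mem_cat => /orP[] /mapP[e eL ->]; [apply: good1 | apply: good2].
Qed.

Lemma eq_splits (F : fieldType) (p : nat) (x : 'rV[F]_p) f g s d :
  f =1 g -> splits x f s d -> splits x g s d.
Proof.
move=> fg [L1 [L2 [size1 size2 good1 good2 cnt]]].
by exists L1, L2; split=> // a; rewrite cnt fg.
Qed.

Lemma splits0 (F : fieldType) (p : nat) (x : 'rV[F]_p) :
  splits x (fun=> 0%N) 0 0.
Proof. by exists [::], [::]. Qed.

Lemma splitsD (F : fieldType) (p : nat) (x : 'rV[F]_p) f1 f2 s1 s2 d1 d2 :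
  splits x f1 s1 d1 -> splits x f2 s2 d2 ->
  splits x (fun a => f1 a + f2 a)%N (s1 + s2) (d1 + d2).
Proof.
move=> [L1 [L2 [size1 size2 good1 good2 cnt]]].
move=> [M1 [M2 [Msize1 Msize2 Mgood1 Mgood2 Mcnt]]].
exists (L1 ++ M1), (L2 ++ M2); split=> [|||| a].
- by rewrite size_cat size1 Msize1.
- by rewrite size_cat size2 Msize2.
- by move=> c; rewrite mem_cat => /orP[/good1|/Mgood1].
- by move=> c; rewrite mem_cat => /orP[/good2|/Mgood2].
- by rewrite -cnt -Mcnt !map_cat !count_cat; lia.
Qed.

Lemma splits_sum (F : fieldType) (p : nat) (x : 'rV[F]_p) (I : Type)
    (r : seq I) (P : pred I) f s d :
  (forall j, P j -> splits x (f j) (s j) (d j)) ->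
  splits x (fun a => \sum_(j <- r | P j) f j a)%N
    (\sum_(j <- r | P j) s j) (\sum_(j <- r | P j) d j).
Proof.
move=> Pf; elim: r => [|j r IHr].
  by rewrite !big_nil; apply: eq_splits (splits0 x) => a; rewrite big_nil.
rewrite !big_cons; case: ifP => Pj.
  by apply: eq_splits (splitsD (Pf j Pj) IHr) => a; rewrite big_cons Pj.
by apply: eq_splits IHr => a; rewrite big_cons Pj.
Qed.

Lemma splits_sum_singles (F : fieldType) (p : nat) (x : 'rV[F]_p) (I : Type)
    (r : seq I) (P : pred I) f s :
  (forall j, P j -> splits x (f j) (s j) 0) ->
  splits x (fun a => \sum_(j <- r | P j) f j a)%N (\sum_(j <- r | P j) s j) 0.
Proof. by move/splits_sum=> /(_ r); rewrite (@big1_eq nat). Qed.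

Lemma splits_sum_pairs (F : fieldType) (p : nat) (x : 'rV[F]_p) (I : Type)
    (r : seq I) (P : pred I) f d :
  (forall j, P j -> splits x (f j) 0 (d j)) ->
  splits x (fun a => \sum_(j <- r | P j) f j a)%N 0 (\sum_(j <- r | P j) d j).
Proof. by move/splits_sum=> /(_ r); rewrite (@big1_eq nat). Qed.

Lemma splits_singles (F : fieldType) (p : nat) (x : 'rV[F]_p) n c :
  (x <= span_of [:: c])%MS -> splits x (fun a => n * a c)%N n 0.
Proof.
move=> good; exists (nseq n c), [::]; split=> // [|c1|a].
- by rewrite size_nseq.
- by rewrite mem_nseq => /andP[_ /eqP->].
- by rewrite count_nseq mulnC !addn0.
Qed.

Lemma splits_pairs (F : fieldType) (p : nat) (x : 'rV[F]_p) l1 l2 :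
  size l1 = size l2 ->
  {in l1 & l2, forall c1 c2, (x <= span_of [:: c1; c2])%MS} ->
  splits x (fun a => count a l1 + count a l2)%N 0 (size l1).
Proof.
move=> size12 good; exists [::], (zip l1 l2); split=> // [|[c1 c2] c12|a].
- by rewrite size1_zip ?size12.
- apply: good => /=.
    by have := map_f fst c12; rewrite -/(unzip1 _) unzip1_zip ?size12.
  by have := map_f snd c12; rewrite -/(unzip2 _) unzip2_zip ?size12.
- by rewrite -/(unzip1 _) -/(unzip2 _) unzip1_zip ?unzip2_zip ?size12.
Qed.

Lemma count_flatten_nseq (T I : Type) (r : seq I) (n : nat) (g : I -> T) a :
  count a (flatten [seq nseq n (g j) | j <- r]) = (\sum_(j <- r) n * a (g j))%N.
Proof.
elim: r => [|j r IHr]; first by rewrite big_nil.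
by rewrite big_cons /= count_cat count_nseq IHr mulnC.
Qed.

(** Since every column of one family works with every column of the other, only the total numbers of
    copies must agree; the two lists are zipped in any order. *)
Lemma splits_blocks (F : fieldType) (p : nat) (x : 'rV[F]_p)
    (I J : finType) (X : {set I}) (Y : {set J}) g h n m :
  (#|X| * n = #|Y| * m)%N ->
  {in X & Y, forall j k, (x <= span_of [:: g j; h k])%MS} ->
  splits x (fun a => \sum_(j in X) n * a (g j) + \sum_(k in Y) m * a (h k))%N
    0 (#|Y| * m).
Proof.
move=> sizeXY good.
pose l1 := flatten [seq nseq n (g j) | j <- enum X].
pose l2 := flatten [seq nseq m (h k) | k <- enum Y].
have size1 : size l1 = (#|X| * n)%N.
  rewrite -count_predT count_flatten_nseq big_enum /=.
  by rewrite (eq_bigr (fun=> n)) ?sum_nat_const // => j _; rewrite muln1.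
have size2 : size l2 = (#|Y| * m)%N.
  rewrite -count_predT count_flatten_nseq big_enum /=.
  by rewrite (eq_bigr (fun=> m)) ?sum_nat_const // => j _; rewrite muln1.
rewrite -sizeXY -size1.
have := @splits_pairs F p x l1 l2; rewrite size1 size2 => /(_ sizeXY) H.
apply: eq_splits (H _) => [a|c1 c2].
  by rewrite !count_flatten_nseq !big_enum.
case/flattenP=> ? /mapP[j jX ->]; rewrite mem_nseq => /andP[_ /eqP->].
case/flattenP=> ? /mapP[k kY ->]; rewrite mem_nseq => /andP[_ /eqP->].
by rewrite !mem_enum in jX kY; apply: good.
Qed.

(** * Double counting of pairs of disjoint subsets *)

Lemma card_ksets (T : finType) (U : {set T}) k : #|ksets U k| = 'C(#|U|, k).
Proof. by rewrite -cards_draws; apply: eq_card => B; rewrite !inE. Qed.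

Lemma sum_ksets_split (T : finType) (U : {set T}) k i (G : {set T} -> nat) :
  (\sum_(B in ksets U k) G B =
   \sum_(B in ksets U k | i \in B) G B + \sum_(B in ksets (U :\ i) k) G B)%N.
Proof.
rewrite (bigID (fun B : {set T} => i \in B)) /=; congr addn.
by apply: eq_bigl => B; rewrite !inE subsetD1 andbAC.
Qed.

Lemma sum_ksets_with (T : finType) (U : {set T}) k i (G : {set T} -> nat) :
  i \in U ->
  (\sum_(C in ksets U k.+1 | i \in C) G C =
   \sum_(E in ksets (U :\ i) k) G (i |: E))%N.
Proof.
move=> iU; rewrite (reindex_onto (fun E => i |: E) (fun C => C :\ i)) /=; last first.
  by move=> C /andP[_ iC]; rewrite setD1K.
apply: eq_bigl => E; rewrite !inE eqxx andbT subUset sub1set iU /= subsetD1.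
case: (boolP (i \in E)) => iE.
  rewrite andbF /=; apply/negbTE; rewrite negb_and; apply/orP; right.
  by apply/eqP=> E'; move: iE; rewrite -E' !inE eqxx.
by rewrite setU1K // eqxx cardsU1 iE /= !andbT.
Qed.

(** Allows columns to be grouped by the index set of the last cell instead of by [B]. *)
Lemma sum_disjoint_ksets (T : finType) (V : {set T}) b e
    (G : {set T} -> {set T} -> nat) :
  (\sum_(B in ksets V b) \sum_(E in ksets (V :\: B) e) G B E =
   \sum_(E in ksets V e) \sum_(B in ksets (V :\: E) b) G B E)%N.
Proof.
rewrite (exchange_big_dep [in ksets V e]) /=; last first.
  move=> B E; rewrite !inE => _ /andP[sE ->]; rewrite andbT.
  exact: subset_trans sE (subsetDl _ _).
apply: eq_bigr => E; rewrite inE => /andP[sEV cardE].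
apply: eq_bigl => B; rewrite !inE !subsetD sEV cardE !andbT /= disjoint_sym.
by rewrite andbAC.
Qed.

(** A pair of disjoint sets is determined by its union and its first member. This groups the columns
    of type T_r by the set of all indices they involve. *)
Lemma sum_ksets_union (T : finType) (V : {set T}) b c
    (G : {set T} -> {set T} -> nat) :
  (\sum_(B in ksets V b) \sum_(C in ksets (V :\: B) c) G B C =
   \sum_(E in ksets V (b + c)) \sum_(B in ksets E b) G B (E :\: B))%N.
Proof.
have step B : B \in ksets V b ->
    (\sum_(C in ksets (V :\: B) c) G B C =
     \sum_(E in ksets V (b + c) | B \subset E) G B (E :\: B))%N.
  rewrite inE => /andP[sBV /eqP cardB].
  rewrite [RHS](reindex_onto (fun C => B :|: C) (fun E => E :\: B)) /=; last first.
    move=> E /andP[_ sBE]; apply/setP=> x; rewrite !inE.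
    by case: (boolP (x \in B)) => [/(subsetP sBE)->|].
  apply: eq_big => [C|C].
    rewrite !inE subsetUl andbT subUset sBV /= subsetD -!andbA; congr andb.
    case: (boolP [disjoint C & B]) => dCB.
      rewrite setDUl setDv set0U (setDidPl dCB) eqxx andbT.
      rewrite cardsU setIC (disjoint_setI0 dCB) cards0 subn0 cardB.
      by rewrite eqn_add2l.
    apply/esym/negbTE/negP=> /andP[_ /eqP dC]; case/negP: dCB.
    by rewrite -dC -setI_eq0 setIDAC setDIl setDv setI0.
  rewrite inE subsetD => /andP[/andP[_ dCB] _].
  by rewrite setDUl setDv set0U (setDidPl dCB).
rewrite (eq_bigr _ step) (exchange_big_dep [in ksets V (b + c)]) /=; last first.
  by move=> B E _ /andP[].
apply: eq_bigr => E Ek; move: (Ek); rewrite inE => /andP[sEV _].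
apply: eq_bigl => B; rewrite !inE.
case: (boolP (B \subset E)) => [sBE|]; last by rewrite !andbF.
rewrite (subset_trans sBE sEV) /=; move: Ek; rewrite inE => ->.
by rewrite !andbT.
Qed.

(** Both sides count ordered pairs of disjoint subsets of sizes [a] and [b], either of which may be
    chosen first. *)
Lemma mul_bin_disjoint n a b :
  ('C(n, a) * 'C(n - a, b) = 'C(n, b) * 'C(n - b, a))%N.
Proof.
have := sum_disjoint_ksets [set: 'I_n] a b (fun _ _ => 1%N).
have H a' b' : (\sum_(B in ksets [set: 'I_n] a')
    \sum_(E in ksets ([set: 'I_n] :\: B) b') 1 = 'C(n, a') * 'C(n - a', b'))%N.
  rewrite (eq_bigr (fun=> 'C(n - a', b'))); last first.
    move=> B; rewrite inE subsetT => /eqP cardB.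
    by rewrite sum1_card card_ksets cardsD setTI cardB cardsT card_ord.
  by rewrite sum_nat_const card_ksets cardsT card_ord.
by rewrite !H.
Qed.

(** The same pairs, counted by choosing their union first. *)
Lemma mul_bin_union n b c :
  ('C(n, b) * 'C(n - b, c) = 'C(n, b + c) * 'C(b + c, b))%N.
Proof.
have := sum_ksets_union [set: 'I_n] b c (fun _ _ => 1%N).
rewrite (eq_bigr (fun=> 'C(n - b, c))); last first.
  move=> B; rewrite inE subsetT => /eqP cardB.
  by rewrite sum1_card card_ksets cardsD setTI cardB cardsT card_ord.
rewrite sum_nat_const card_ksets cardsT card_ord => ->.
rewrite (eq_bigr (fun=> 'C(b + c, b))); last first.
  by move=> E; rewrite inE subsetT => /eqP cardE; rewrite sum1_card card_ksets cardE.
by rewrite sum_nat_const card_ksets cardsT card_ord.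
Qed.

(** * Recovering [x_i] from one or two columns, and the shape of the code *)

Definition xsum (F : fieldType) (p : nat) (A : {set 'I_p}) : 'rV[F]_p :=
  \sum_(c in A) xvec F c.

Lemma recover_colA (F : fieldType) (p : nat) (A : {set 'I_p}) i :
  i \in A -> (xvec F i <= span_of [:: colA F A])%MS.
Proof.
move=> iA; apply: (mem_span_of (mem_head _ _)).
by apply/mapP; exists i; rewrite ?mem_enum.
Qed.

Lemma recover_colB (F : fieldType) (p : nat) (B : {set 'I_p}) v i :
  i \in B -> (xvec F i <= span_of [:: colB B v])%MS.
Proof.
move=> iB; apply: (mem_span_of (mem_head _ _)).
by rewrite mem_rcons inE map_f ?orbT ?mem_enum.
Qed.

(** The column [c1] yields the sum over [C1] and the remaining terms of [D] one by one, so the sum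
    over [D] can be subtracted. Taking [C1] empty covers a first column of type T_1; otherwise [C1]
    is the index set of the last cell of [c1]. *)
Lemma recover_pair (F : fieldType) (p : nat) (i : 'I_p) (D C1 : {set 'I_p})
    c1 (B : {set 'I_p}) :
  i \notin D -> C1 \subset D -> (xsum F C1 <= span_of [:: c1])%MS ->
  {in D :\: C1, forall g, xvec F g \in c1} ->
  (xvec F i <= span_of [:: c1; colB B (xsum F (i |: D))])%MS.
Proof.
move=> iD sCD; set W := span_of [:: c1; _] => C1c1 Dc1.
have c1W : (span_of [:: c1] <= W)%MS.
  apply: span_of_sub => c v; rewrite inE => /eqP-> vc.
  by apply: mem_span_of vc; rewrite mem_head.
have -> : xvec F i = xsum F (i |: D) - (xsum F C1 + xsum F (D :\: C1)).
  have -> : xsum F C1 + xsum F (D :\: C1) = xsum F D.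
    by rewrite /xsum [RHS](big_setID C1) /= (setIidPr sCD).
  by rewrite /xsum big_setU1 //= addrK.
apply: addmx_sub.
  apply: (@mem_span_of _ _ _ (colB B (xsum F (i |: D)))).
    by rewrite !inE eqxx orbT.
  by rewrite mem_rcons mem_head.
rewrite eqmx_opp; apply: addmx_sub; first exact: submx_trans C1c1 c1W.
apply: summx_sub => g /Dc1 gc1; apply: submx_trans c1W.
by apply: mem_span_of gc1; rewrite mem_head.
Qed.

Lemma sum_ksubsets (p k : nat) (U : {set 'I_p}) (G : {set 'I_p} -> nat) :
  (\sum_(A <- [seq A : {set 'I_p} <- ksubsets p k | A \subset U]) G A =
   \sum_(A in ksets U k) G A)%N.
Proof.
rewrite big_filter big_filter_cond big_enum_cond /=.
by apply: eq_bigl => A; rewrite !inE andbC.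
Qed.

Lemma sum_all_ksubsets (p k : nat) (G : {set 'I_p} -> nat) :
  (\sum_(A <- ksubsets p k) G A = \sum_(A in ksets [set: 'I_p] k) G A)%N.
Proof.
rewrite -sum_ksubsets big_filter; apply: eq_bigl => A.
by rewrite subsetT.
Qed.

Lemma count_flatten_map (T I : Type) (r : seq I) (g : I -> seq T) a :
  count a (flatten [seq g j | j <- r]) = (\sum_(j <- r) count a (g j))%N.
Proof. by rewrite count_flatten -map_comp sumnE big_map. Qed.

Lemma count_code_C (F : fieldType) (p t q : nat) (xi : nat -> nat) a :
  count a (code_C F p t q xi) =
  (\sum_(A in ksets [set: 'I_p] t) xi 1 * a (colA F A)
   + (\sum_(2 <= r < q) \sum_(B in ksets [set: 'I_p] t.-1)
        \sum_(D in ksets (~: B) (r.-1 * t).+1) xi r * a (colB B (xsum F D))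
   + \sum_(B in ksets [set: 'I_p] t.-1) xi q * a (colB B (xsum F (~: B)))))%N.
Proof.
rewrite /code_C !count_cat !count_flatten_nseq !sum_all_ksubsets.
congr (_ + (_ + _))%N; rewrite count_flatten_map; apply: eq_bigr => r _.
rewrite count_flatten_map sum_all_ksubsets; apply: eq_bigr => B _.
by rewrite count_flatten_nseq sum_ksubsets.
Qed.

Lemma code_C_array (F : fieldType) (p t q : nat) (xi : nat -> nat) :
  (0 < t)%N -> is_array_code t (code_C F p t q xi).
Proof.
move=> t0; have szB (B : {set 'I_p}) (v : 'rV[F]_p) :
    B \in ksubsets p t.-1 -> size (colB B v) == t.
  rewrite mem_filter => /andP[/eqP cardB _].
  by rewrite size_rcons size_map -cardE cardB prednK.
apply/allP=> c; rewrite !mem_cat => /or3P[] /flattenP[l].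
- case/mapP=> A; rewrite mem_filter => /andP[/eqP cardA _] ->.
  by rewrite mem_nseq => /andP[_ /eqP->]; rewrite size_map -cardE cardA.
- case/mapP=> r _ -> /flattenP[l' /mapP[B Bk ->]] /flattenP[l'' /mapP[D _ ->]].
  by rewrite mem_nseq => /andP[_ /eqP->]; apply: szB.
- case/mapP=> B Bk ->; rewrite mem_nseq => /andP[_ /eqP->]; exact: szB.
Qed.

(** * Sorting and pairing the columns for a fixed [i] *)

Definition others (p : nat) (i : 'I_p) : {set 'I_p} := [set: 'I_p] :\ i.

Lemma card_others (p : nat) (i : 'I_p) : #|others i| = p.-1.
Proof.
have := cardsD1 i [set: 'I_p]; rewrite inE cardsT card_ord add1n.
by move/(congr1 predn) => ->.
Qed.

Lemma setC_D1 (p : nat) (i : 'I_p) (B : {set 'I_p}) :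
  (~: B) :\ i = others i :\: B.
Proof. by apply/setP=> x; rewrite !inE andbT andbC. Qed.

Lemma card_othersD (p : nat) (i : 'I_p) (k : nat) (B : {set 'I_p}) :
  B \in ksets (others i) k -> #|others i :\: B| = (p.-1 - k)%N.
Proof.
by rewrite inE => /andP[sB /eqP cardB]; rewrite cardsD (setIidPr sB) card_others cardB.
Qed.

Lemma splits_colA_with (F : fieldType) (p t n : nat) (i : 'I_p) :
  (0 < t)%N ->
  splits (xvec F i)
    (fun a => \sum_(A in ksets [set: 'I_p] t | i \in A) n * a (colA F A))%N
    ('C(p.-1, t.-1) * n) 0.
Proof.
move=> t0; have -> : ('C(p.-1, t.-1) * n =
    \sum_(A in ksets [set: 'I_p] t | i \in A) n)%N.
  by rewrite -(prednK t0) sum_ksets_with // sum_nat_const card_ksets card_others.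
by apply: splits_sum_singles => A /andP[_ iA]; apply: splits_singles; apply: recover_colA.
Qed.

(** The family [Ds] of last-cell index sets is left free to serve both the types T_r, with all
    subsets of given size of the complement of [B], and T_q, with the complement alone. *)
Lemma splits_colB_with (F : fieldType) (p b n : nat) (i : 'I_p)
    (Ds : {set 'I_p} -> {set {set 'I_p}}) k :
  (0 < b)%N ->
  (forall B, B \in ksets [set: 'I_p] b -> #|Ds B| = k) ->
  splits (xvec F i)
    (fun a => \sum_(B in ksets [set: 'I_p] b | i \in B)
                \sum_(D in Ds B) n * a (colB B (xsum F D)))%N
    ('C(p.-1, b.-1) * (k * n)) 0.
Proof.
move=> b0 cardD; have -> : ('C(p.-1, b.-1) * (k * n) =
    \sum_(B in ksets [set: 'I_p] b | i \in B) \sum_(D in Ds B) n)%N.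
  rewrite (eq_bigr (fun=> (k * n)%N)); last first.
    by move=> B /andP[Bk _]; rewrite sum_nat_const cardD.
  by rewrite -(prednK b0) sum_ksets_with // sum_nat_const card_ksets card_others.
apply: splits_sum_singles => B /andP[_ iB]; apply: splits_sum_singles => D _.
by apply: splits_singles; apply: recover_colB.
Qed.

(* [miss1] and [miss] count the columns of types T_1 and T_r not involving [x_i];
   [hit] and [hitq] count those of types T_(r+1) (not T_r) and T_q in which [x_i]
   occurs only in the last cell. *)
Definition miss1 (F : fieldType) (p : nat) (i : 'I_p) (t n : nat)
    (a : pred (seq 'rV[F]_p)) : nat :=
  \sum_(A in ksets (others i) t) n * a (colA F A).

Definition miss (F : fieldType) (p : nat) (i : 'I_p) (t r n : nat)
    (a : pred (seq 'rV[F]_p)) : nat :=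
  \sum_(B in ksets (others i) t.-1)
    \sum_(D in ksets (others i :\: B) (r.-1 * t).+1) n * a (colB B (xsum F D)).

Definition hit (F : fieldType) (p : nat) (i : 'I_p) (t r n : nat)
    (a : pred (seq 'rV[F]_p)) : nat :=
  \sum_(B in ksets (others i) t.-1)
    \sum_(E in ksets (others i :\: B) (r * t)) n * a (colB B (xsum F (i |: E))).

Definition hitq (F : fieldType) (p : nat) (i : 'I_p) (t n : nat)
    (a : pred (seq 'rV[F]_p)) : nat :=
  \sum_(B in ksets (others i) t.-1)
    n * a (colB B (xsum F (i |: (others i :\: B)))).

Lemma xsum_mem_colB (F : fieldType) (p : nat) (B D : {set 'I_p}) :
  (xsum F D <= span_of [:: colB B (xsum F D)])%MS.
Proof. by apply: (mem_span_of (mem_head _ _)); rewrite mem_rcons mem_head. Qed.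

Lemma splits_miss1_hit (F : fieldType) (p : nat) (i : 'I_p) (t n m : nat) :
  n = ('C(p.-1 - t, t.-1) * m)%N ->
  splits (xvec F i) (fun a => miss1 i t n a + hit i t 1 m a)%N
    0 ('C(p.-1, t) * ('C(p.-1 - t, t.-1) * m)).
Proof.
move=> nm.
(* Columns are grouped by the [t]-set [E]; the singleton [[set E]] gives the T_1 side the form
   expected by [splits_blocks]. *)
apply: (@eq_splits _ _ _ (fun a => \sum_(E in ksets (others i) t)
   (\sum_(A in [set E]) n * a (colA F A)
    + \sum_(B in ksets (others i :\: E) t.-1) m * a (colB B (xsum F (i |: E)))))%N).
  move=> a; rewrite big_split /=; congr addn.
    by apply: eq_bigr => E _; rewrite big_set1.
  by rewrite /hit mul1n sum_disjoint_ksets.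
rewrite -(card_others i) -(card_ksets (others i) t) -sum_nat_const.
apply: splits_sum_pairs => E Ek.
rewrite card_others -(card_othersD Ek) -card_ksets; apply: splits_blocks.
  by rewrite cards1 mul1n card_ksets (card_othersD Ek).
move=> A B /set1P-> _; move: Ek; rewrite inE => /andP[sE _].
apply: (@recover_pair _ _ _ _ set0); rewrite ?sub0set //.
- by apply/negP=> /(subsetP sE); rewrite !inE eqxx.
- by rewrite /xsum big_set0 sub0mx.
- by move=> g; rewrite setD0 => gE; apply/mapP; exists g; rewrite ?mem_enum.
Qed.

(** Grouping is by the [r * t] indices [E] of the first column. There are ['C(r * t, t.-1)] ways to
    choose its [B] inside [E], against ['C(p.-1 - r * t, t.-1)] ways to choose the [B] of the second
    column outside [E] and [i]; the hypothesis balances the copies. *)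
Lemma splits_miss_hit (F : fieldType) (p : nat) (i : 'I_p) (t r n m : nat) :
  (0 < t)%N -> (0 < r)%N ->
  ('C(r * t, t.-1) * n = 'C(p.-1 - r * t, t.-1) * m)%N ->
  splits (xvec F i) (fun a => miss i t r n a + hit i t r m a)%N
    0 ('C(p.-1, r * t) * ('C(p.-1 - r * t, t.-1) * m)).
Proof.
move=> t0 r0 nm.
apply: (@eq_splits _ _ _ (fun a => \sum_(E in ksets (others i) (r * t))
   (\sum_(B in ksets E t.-1) n * a (colB B (xsum F (E :\: B)))
    + \sum_(B in ksets (others i :\: E) t.-1) m * a (colB B (xsum F (i |: E)))))%N).
  move=> a; rewrite big_split /=; congr addn.
    rewrite /miss sum_ksets_union; apply: eq_bigl => E.
    by congr (_ \in ksets _ _); case: (r) r0 => // r' _; rewrite mulSn; lia.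
  by rewrite /hit sum_disjoint_ksets.
rewrite -(card_others i) -(card_ksets (others i) (r * t)) -sum_nat_const.
apply: splits_sum_pairs => E Ek; rewrite card_others -(card_othersD Ek) -card_ksets.
move: (Ek); rewrite inE => /andP[sE /eqP cardE].
apply: splits_blocks.
  by rewrite !card_ksets (card_othersD Ek) cardE.
move=> B B'; rewrite inE => /andP[sBE _] _.
apply: (@recover_pair _ _ _ _ (E :\: B)); rewrite ?subsetDl ?xsum_mem_colB //.
- by apply/negP=> /(subsetP sE); rewrite !inE eqxx.
- move=> g; rewrite setDDr setDv set0U inE => /andP[_ gB].
  by rewrite mem_rcons inE map_f ?orbT ?mem_enum.
Qed.

(** For each [D], the column with cells from [B] and last cell over [D] is paired with the T_q
    column of [phi B]. What must be cancelled beyond [D] lies outside [phi B], hence in [B] by the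
    covering property. *)
Lemma splits_miss_hitq (F : fieldType) (p : nat) (i : 'I_p) (t r n : nat) :
  (p.-1 - (r.-1 * t).+1 <= t.-1.*2)%N ->
  splits (xvec F i) (fun a => miss i t r n a
      + hitq i t ('C(p.-1 - t.-1, (r.-1 * t).+1) * n) a)%N
    0 ('C(p.-1, (r.-1 * t).+1) * ('C(p.-1 - (r.-1 * t).+1, t.-1) * n)).
Proof.
set c := (r.-1 * t).+1 => lec.
apply: (@eq_splits _ _ _ (fun a => \sum_(D in ksets (others i) c)
   (\sum_(B in ksets (others i :\: D) t.-1) n * a (colB B (xsum F D))
    + \sum_(B in ksets (others i :\: D) t.-1)
        n * a (colB B (xsum F (i |: (others i :\: B))))))%N).
  (* The binomial factor in the multiplicity of [hitq] is the number of sets [D] disjoint from [B],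
     so its copies are shared out as [n] for each [D]. *)
  move=> a; rewrite big_split /= /miss sum_disjoint_ksets; congr addn.
  rewrite -sum_disjoint_ksets /hitq; apply: eq_bigr => B Bk.
  by rewrite sum_nat_const card_ksets (card_othersD Bk) mulnA.
rewrite -(card_others i) -(card_ksets (others i) c) -sum_nat_const.
apply: splits_sum_pairs => D Dk; rewrite card_others -(card_othersD Dk) -card_ksets.
move: (Dk); rewrite inE => /andP[sD _].
have [phi [inj_phi phik cover]] : exists phi : {set 'I_p} -> {set 'I_p},
    [/\ {in ksets (others i :\: D) t.-1 &, injective phi},
        {in ksets (others i :\: D) t.-1, forall B, phi B \in ksets (others i :\: D) t.-1} &
        {in ksets (others i :\: D) t.-1, forall B, others i :\: D \subset B :|: phi B}].
  by apply: covering_permutation; rewrite (card_othersD Dk).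
(* An injective self-map of a finite set is onto, so reindexing by [phi] uses each T_q column
   exactly once for this [D]. *)
have phiX : phi @: ksets (others i :\: D) t.-1 = ksets (others i :\: D) t.-1.
  apply/eqP; rewrite eqEcard card_in_imset // leqnn andbT.
  by apply/subsetP=> _ /imsetP[B Bk ->]; apply: phik.
apply: (@eq_splits _ _ _ (fun a => \sum_(B in ksets (others i :\: D) t.-1)
  (\sum_(B0 in [set B]) n * a (colB B0 (xsum F D)) +
   \sum_(B0 in [set B]) n * a (colB (phi B0) (xsum F (i |: (others i :\: phi B0))))))%N).
  move=> a; rewrite big_split /=; congr addn.
    by apply: eq_bigr => B _; rewrite big_set1.
  rewrite -[in RHS]phiX big_imset //=; apply: eq_bigr => B _.
  by rewrite big_set1.
rewrite -sum_nat_const; apply: splits_sum_pairs => B Bk.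
rewrite -[X in splits _ _ _ X]mul1n -[X in (X * _)%N](cards1 B).
apply: splits_blocks => [|B1 B2 /set1P-> /set1P->].
  by rewrite cards1 !mul1n.
apply: (@recover_pair _ _ _ _ D); rewrite ?xsum_mem_colB //.
- by rewrite !inE eqxx andbF.
- rewrite subsetD sD; move: (phik B Bk); rewrite inE subsetD => /andP[/andP[_]].
  by rewrite disjoint_sym => ->.
- move=> g; rewrite !inE => /and3P[gD gphi gi].
  rewrite mem_rcons inE map_f ?orbT // mem_enum.
  have /subsetP/(_ g) := cover B Bk.
  by rewrite !inE gD gi (negbTE gphi) orbF => ->.
Qed.

(** Columns are sorted by the place of [x_i]: among the first cells, nowhere, or only in the last
    cell. The last two kinds are then regrouped so that T_r without [x_i] faces T_(r+1). *)
Lemma count_code_C_split (F : fieldType) (p t q : nat) (xi : nat -> nat)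
    (i : 'I_p) a :
  (2 < q)%N ->
  count a (code_C F p t q xi) =
  ((\sum_(A in ksets [set: 'I_p] t | i \in A) xi 1 * a (colA F A)
    + (\sum_(2 <= r < q) \sum_(B in ksets [set: 'I_p] t.-1 | i \in B)
         \sum_(D in ksets (~: B) (r.-1 * t).+1) xi r * a (colB B (xsum F D))
       + \sum_(B in ksets [set: 'I_p] t.-1 | i \in B)
         \sum_(D in [set ~: B]) xi q * a (colB B (xsum F D))))
   + ((miss1 i t (xi 1) a + hit i t 1 (xi 2) a)
    + (\sum_(2 <= r < q.-1) (miss i t r (xi r) a + hit i t r (xi r.+1) a)
       + (miss i t q.-1 (xi q.-1) a + hitq i t (xi q) a))))%N.
Proof.
move=> q2; rewrite count_code_C (sum_ksets_split _ _ i) -/(others i) -/(miss1 _ _ _ _).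
have -> : (\sum_(2 <= r < q) \sum_(B in ksets [set: 'I_p] t.-1)
        \sum_(D in ksets (~: B) (r.-1 * t).+1) xi r * a (colB B (xsum F D)) =
   \sum_(2 <= r < q) \sum_(B in ksets [set: 'I_p] t.-1 | i \in B)
         \sum_(D in ksets (~: B) (r.-1 * t).+1) xi r * a (colB B (xsum F D))
   + \sum_(2 <= r < q) hit i t r.-1 (xi r) a
   + \sum_(2 <= r < q) miss i t r (xi r) a)%N.
  rewrite -!big_split /=; apply: eq_bigr => r _.
  rewrite (sum_ksets_split _ _ i) -/(others i) -addnA; congr addn.
  rewrite -big_split /=; apply: eq_bigr => B; rewrite inE => /andP[sB _].
  rewrite (sum_ksets_split _ _ i) setC_D1; congr addn.
  rewrite sum_ksets_with ?setC_D1 // inE.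
  by apply/negP=> /(subsetP sB); rewrite !inE eqxx.
have -> : (\sum_(B in ksets [set: 'I_p] t.-1) xi q * a (colB B (xsum F (~: B))) =
   \sum_(B in ksets [set: 'I_p] t.-1 | i \in B)
         \sum_(D in [set ~: B]) xi q * a (colB B (xsum F D)) + hitq i t (xi q) a)%N.
  rewrite (sum_ksets_split _ _ i) -/(others i); congr addn.
    by apply: eq_bigr => B _; rewrite big_set1.
  apply: eq_bigr => B; rewrite inE => /andP[sB _]; rewrite -setC_D1 setD1K // inE.
  by apply/negP=> /(subsetP sB); rewrite !inE eqxx.
(* The shift by one: [hit] at [r] consists of T_(r+1) columns, so T_2 is detached to face T_1. *)
have -> : (\sum_(2 <= r < q) hit i t r.-1 (xi r) a =
    hit i t 1 (xi 2) a + \sum_(2 <= r < q.-1) hit i t r (xi r.+1) a)%N.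
  by rewrite big_ltn // -{1}(prednK (ltnW (ltnW q2))) big_add1.
have -> : (\sum_(2 <= r < q) miss i t r (xi r) a =
    \sum_(2 <= r < q.-1) miss i t r (xi r) a + miss i t q.-1 (xi q.-1) a)%N.
  by case: q q2 => // q q2; rewrite big_nat_recr.
by rewrite big_split /=; ring.
Qed.

Lemma splits_code_C (F : fieldType) (p t q : nat) (xi : nat -> nat) (i : 'I_p) :
  (1 < t)%N -> (2 < q)%N -> (p <= q * t)%N ->
  xi 1%N = ('C(p.-1 - t, t.-1) * xi 2)%N ->
  (forall r, (2 <= r < q.-1)%N ->
     'C(r * t, t.-1) * xi r = 'C(p.-1 - r * t, t.-1) * xi r.+1)%N ->
  xi q = ('C(p.-1 - t.-1, (q.-2 * t).+1) * xi q.-1)%N ->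
  splits (xvec F i) (fun a => count a (code_C F p t q xi))
   ('C(p.-1, t.-1) * xi 1
    + (\sum_(2 <= r < q) 'C(p.-1, t.-2) * ('C(p - t.-1, (r.-1 * t).+1) * xi r)
       + 'C(p.-1, t.-2) * (1 * xi q)))
   ('C(p.-1, t) * ('C(p.-1 - t, t.-1) * xi 2)
    + (\sum_(2 <= r < q.-1) 'C(p.-1, r * t) * ('C(p.-1 - r * t, t.-1) * xi r.+1)
       + 'C(p.-1, (q.-2 * t).+1) * ('C(p.-1 - (q.-2 * t).+1, t.-1) * xi q.-1))).
Proof.
move=> t1 q2 leq_p xi1 xir xiq.
have t0 : (0 < t)%N by lia.
have S1 := @splits_colA_with F p t (xi 1%N) i t0.
have Sr : splits (xvec F i) (fun a => \sum_(2 <= r < q)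
         \sum_(B in ksets [set: 'I_p] t.-1 | i \in B)
         \sum_(D in ksets (~: B) (r.-1 * t).+1) xi r * a (colB B (xsum F D)))%N
    (\sum_(2 <= r < q) 'C(p.-1, t.-2) * ('C(p - t.-1, (r.-1 * t).+1) * xi r)) 0.
  apply: splits_sum_singles => r _.
  apply: (@splits_colB_with F p t.-1 _ i (fun B => ksets (~: B) _)); first by lia.
  move=> B; rewrite inE => /andP[_ /eqP cardB].
  by rewrite card_ksets cardsCs setCK card_ord cardB.
have Sq := @splits_colB_with F p t.-1 (xi q) i (fun B => [set ~: B]) 1
  ltac:(lia) (fun B _ => cards1 _).
have P1 := splits_miss1_hit F i xi1.
have Pr : splits (xvec F i)
    (fun a => \sum_(2 <= r < q.-1) (miss i t r (xi r) a + hit i t r (xi r.+1) a))%N 0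
    (\sum_(2 <= r < q.-1) 'C(p.-1, r * t) * ('C(p.-1 - r * t, t.-1) * xi r.+1)).
  rewrite big_nat_cond; apply: eq_splits (splits_sum_pairs _ _); last first.
    move=> r /andP[r2q _]; apply: (splits_miss_hit F i t0 _ (xir r r2q)); lia.
  by move=> a; rewrite [RHS]big_nat_cond.
(* From [p <= q * t]: the complement of [D] and [i] is small enough for two [t.-1]-subsets to cover
   it. *)
have leq_r : (p.-1 - (q.-2 * t).+1 <= t.-1.*2)%N.
  by case: q q2 leq_p {xir xiq Sr Sq Pr} => [|[|q]] //= _; lia.
have := @splits_miss_hitq F p i t q.-1 (xi q.-1) leq_r; rewrite -xiq => Pq.
have := splitsD (splitsD S1 (splitsD Sr Sq)) (splitsD P1 (splitsD Pr Pq)).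
rewrite !addn0 !add0n; apply: eq_splits => a.
by rewrite (count_code_C_split _ _ i).
Qed.

(** * Binomial identities for the rate and for the multiplicities *)

(** In [d], exchanging the order of choice turns each product of binomials into ['C(p.-1, t.-1)]
    times a binomial of [p - t]. In [s], the factor ['C(p.-1, t.-2)] is converted by the identity
    [bin]. *)
Lemma rate_identity (p t q : nat) (xi : nat -> nat) s d :
  (1 < t)%N -> (t <= p)%N -> (2 < q)%N ->
  xi q = ('C(p.-1 - t.-1, (q.-2 * t).+1) * xi q.-1)%N ->
  s = ('C(p.-1, t.-1) * xi 1
    + (\sum_(2 <= r < q) 'C(p.-1, t.-2) * ('C(p - t.-1, (r.-1 * t).+1) * xi r)
       + 'C(p.-1, t.-2) * (1 * xi q)))%N ->
  d = ('C(p.-1, t) * ('C(p.-1 - t, t.-1) * xi 2)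
    + (\sum_(2 <= r < q.-1) 'C(p.-1, r * t) * ('C(p.-1 - r * t, t.-1) * xi r.+1)
       + 'C(p.-1, (q.-2 * t).+1) * ('C(p.-1 - (q.-2 * t).+1, t.-1) * xi q.-1)))%N ->
  ((p - t + 1) * s = 'C(p.-1, t.-1) * beta_of p t q xi /\
   (p - t + 1) * d = 'C(p.-1, t.-1) * gamma_of p t q xi)%N.
Proof.
move=> t1 tp q2 xiq -> ->.
have bin : ((p - t + 1) * 'C(p.-1, t.-2) = (t - 1) * 'C(p.-1, t.-1))%N.
  have := mul_bin_left p.-1 t.-2.
  have -> : t.-2.+1 = t.-1 by lia.
  by move=> H; rewrite (_ : t - 1 = t.-1)%N ?H; [congr muln; lia | lia].
have pt : (p.-1 - t.-1 = p - t)%N by lia.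
have pt1 : (p - t.-1 = p - t + 1)%N by lia.
split; rewrite /beta_of /gamma_of; last first.
  rewrite [RHS]mulnCA; congr muln.
  rewrite [in RHS]big_ltn; last by lia.
  rewrite !mulnDr -addnA; congr (_ + (_ + _))%N.
  - by rewrite mulnA mul_bin_disjoint pt mul1n; ring.
  - rewrite subn1 big_distrr /=; apply: eq_bigr => r _.
    by rewrite mulnA mul_bin_disjoint pt; ring.
  - by rewrite mulnA mul_bin_disjoint -mulnA -xiq.
move: bin; rewrite pt1 mul1n; move: (p - t + 1)%N => N bin.
rewrite !mulnDr -!addnA; congr (_ + (_ + _))%N; first by ring.
  rewrite !big_distrr /=; apply: eq_bigr => r _.
  by rewrite mulnA bin subn1 [in RHS]subn1 addn1; ring.
by rewrite mulnA bin; ring.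
Qed.

(** The bounds on [p] are [q - 1 < s <= q] multiplied by [t]. *)
Lemma ceil_bounds (s : rat) (t p q : nat) :
  2 < s -> (0 < t)%N -> p%:Q = s * t%:Q -> q%:Z = Num.ceil s ->
  [/\ (2 < q)%N, (q.-1 * t < p)%N & (p <= q * t)%N].
Proof.
move=> s2 t0 ps qs.
have tQ : (0 : rat) < t%:Q by rewrite ltr0z.
have /andP[lts les] : q%:Q - 1 < s <= q%:Q.
  by have := ceil_itv s; rewrite -qs intrB.
have q2 : (2 < q)%N by rewrite -ltz_nat -(ltr_int rat); apply: lt_le_trans s2 les.
split=> //.
  have : (q.-1)%:Q * t%:Q < p%:Q.
    rewrite ps ltr_pM2r //; apply: le_lt_trans lts.
    by rewrite -{2}(prednK (ltnW (ltnW q2))) -addn1 PoszD intrD addrK.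
  by rewrite -intrM ltr_int.
have : p%:Q <= q%:Q * t%:Q by rewrite ps ler_pM2r.
by rewrite -intrM ler_int.
Qed.

(** By absorption, [t * 'C(p - t, t)] equals [p - t] times ['C(p.-1 - t, t.-1)], and the positive
    factor [p - t] cancels. *)
Lemma type1_multiplicity (p t x1 x2 : nat) :
  (0 < t)%N -> (t < p)%N -> ((p - t) * x1 = t * 'C(p - t, t) * x2)%N ->
  x1 = ('C(p.-1 - t, t.-1) * x2)%N.
Proof.
move=> t0 ltp E; apply/eqP; rewrite -(eqn_pmul2l (m := p - t)) ?subn_gt0 //.
have := mul_bin_diag (p - t) t.-1; rewrite prednK // mulnA E => <-.
by rewrite (_ : (p - t).-1 = p.-1 - t)%N //; lia.
Qed.

(** After multiplication by ['C(p.-1, r * t)], positive because [r * t < p], both sides become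
    ['C(p.-1, t.-1)] times those of the hypothesis. *)
Lemma typer_multiplicity (p t r x y : nat) :
  (0 < t)%N -> (0 < r)%N -> (r * t < p)%N ->
  ('C(p - t, (r - 1) * t + 1) * x = 'C(p - t, r * t) * y)%N ->
  ('C(r * t, t.-1) * x = 'C(p.-1 - r * t, t.-1) * y)%N.
Proof.
move=> t0 r0 ltp E.
have leb : (0 < 'C(p.-1, r * t))%N by rewrite bin_gt0; lia.
apply/eqP; rewrite -(eqn_pmul2l leb) !mulnA mul_bin_disjoint; apply/eqP.
have lerp : (t <= r * t)%N by rewrite leq_pmull.
have pt : (p.-1 - t.-1 = p - t)%N by lia.
have := mul_bin_union p.-1 t.-1 ((r - 1) * t + 1).
have -> : (t.-1 + ((r - 1) * t + 1) = r * t)%N by rewrite mulnBl mul1n; lia.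
by rewrite pt => <-; rewrite -!mulnA E.
Qed.

Lemma ratio_scale (N M k m x y : nat) :
  (0 < N)%N -> (0 < M)%N -> (N * k = M * x)%N -> (N * m = M * y)%N ->
  k%:Q / m%:Q = x%:Q / y%:Q.
Proof.
move=> N0 M0 kx my.
have NQ : N%:Q != 0 by rewrite intr_eq0; lia.
have MQ : M%:Q != 0 by rewrite intr_eq0; lia.
transitivity ((N * k)%N%:Q / (N * m)%N%:Q).
  by rewrite !PoszM !intrM -mulf_div divff // mul1r.
by rewrite kx my !PoszM !intrM -mulf_div divff // mul1r.
Qed.

Theorem theorem12 (F : finFieldType) (s : rat) (t p q : nat) (xi : nat -> nat) :
  2 < s -> s \notin Num.int ->
  (1 < t)%N -> p%:Q = s * t%:Q ->
  q%:Z = Num.ceil s ->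
  (forall r, (1 <= r <= q)%N -> (0 < xi r)%N) ->
  (xi q.-1 * 'C(p - t, (q - 2) * t + 1) = xi q)%N ->
  (forall r, (2 <= r <= q - 2)%N ->
     ('C(p - t, (r - 1) * t + 1) * xi r = 'C(p - t, r * t) * xi r.+1)%N) ->
  ((p - t) * xi 1 = t * 'C(p - t, t) * xi 2)%N ->
  let C := code_C F p t q xi in
  let m := size C in
  is_array_code t C /\
  exists k : nat, is_kPIR C k /\
    k%:Q / m%:Q = (beta_of p t q xi + gamma_of p t q xi)%:Q
                  / (beta_of p t q xi + 2 * gamma_of p t q xi)%:Q.
Proof.
move=> s2 _ t1 ps qs _ xiq xir xi1 C m.
have t0 := ltnW t1.
have [q2 ltp lep] := ceil_bounds s2 t0 ps qs.
have mono r : (r <= q.-1 -> r * t < p)%N.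
  by move=> ler; apply: leq_ltn_trans ltp; rewrite leq_mul2r ler orbT.
have tp : (t < p)%N by rewrite -[t]mul1n mono //; lia.
split; first exact: code_C_array.
have {}xi1 := type1_multiplicity t0 tp xi1.
have {}xir r : (2 <= r < q.-1)%N ->
    ('C(r * t, t.-1) * xi r = 'C(p.-1 - r * t, t.-1) * xi r.+1)%N.
  move=> rq; apply: typer_multiplicity => //; [lia | apply: mono; lia | apply: xir; lia].
have {}xiq : xi q = ('C(p.-1 - t.-1, (q.-2 * t).+1) * xi q.-1)%N.
  rewrite -xiq mulnC subn2 addn1; congr ('C(_, _) * _)%N; lia.
(* The numbers of singles and pairs do not depend on [i], so one [k] serves all indices. *)
have splitC (i : 'I_p) := splits_code_C F i t1 q2 lep xi1 xir xiq.
have [] := rate_identity t1 (ltnW tp) q2 xiq erefl erefl.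
set k1 := (X in (_ * X = _)%N -> _) => eq1; set k2 := (X in (_ * X = _)%N -> _) => eq2.
exists (k1 + k2)%N; split; first exact: splits_is_kPIR.
(* Some index is needed to read the number of columns off a splitting; [p] is positive. *)
have i0 : 'I_p by apply: (@Ordinal _ 0); lia.
have -> : m = (k1 + 2 * k2)%N := splits_size (splitC i0).
apply: (@ratio_scale (p - t + 1) 'C(p.-1, t.-1)).
- by rewrite addn1.
- by rewrite bin_gt0; lia.
- by rewrite mulnDr eq1 eq2 -mulnDr.
- by rewrite mulnDr mulnCA eq1 eq2 mulnCA -mulnDr.
Qed.
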